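(* There are absolute constants $Q_0<\infty$ and $c_0>0$ such that for all integers $2\le t\le q$, $$q\ge Q_0t^2\quad\Longrightarrow\quad c^{\mathrm{lin}}_{q+1,t+1}\le t-\frac{c_0}{t},$$ where $$c^{\mathrm{lin}}_{r,k}=\limsup_{n\to\infty}\frac{\operatorname{ex}^{\mathrm{lin}}_r(n,C^r_{1,k})}{n}.$$
   Context: A hypergraph is $r$-uniform if every edge is an $r$-element set of vertices, and linear if any two distinct edges share at most one vertex. For $3\le k\le r$ the crown $C^r_{1,k}$ consists of a base edge $e_0$ and pairwise disjoint edges (petals) $e_1,\dots,e_k$ with $e_0\cap e_i=\{v_i\}$, where $v_1,\dots,v_k$ are distinct points of $e_0$; a hypergraph is $C^r_{1,k}$-free if it contains no such configuration of edges. $\operatorname{ex}^{\mathrm{lin}}_r(n,C^r_{1,k})$ is the maximum number of edges of a linear $C^r_{1,k}$-free $r$-uniform hypergraph on $n$ vertices. *)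

(* Defs.v *)
From mathcomp Require Import all_boot all_order all_algebra.
From mathcomp Require Import all_classical all_reals all_analysis.

Set Implicit Arguments.
Unset Strict Implicit.
Unset Printing Implicit Defensive.

Import Order.TTheory GRing.Theory Num.Theory.

Definition uniform (V : finType) (r : nat) (H : {set {set V}}) : bool :=
  [forall e in H, #|e| == r].

Definition linear_hypergraph (V : finType) (H : {set {set V}}) : bool :=
  [forall e in H, forall f in H, (e != f) ==> (#|e :&: f| <= 1)].

(* The uniformity r of the crown C^r_{1,k} does not appear: it is that of the
   host hypergraph, from which the base e0 and the petals e i are taken. *)
Definition crown (V : finType) (k : nat) (e0 : {set V})
    (e : {ffun 'I_k -> {set V}}) (v : {ffun 'I_k -> V}) : bool :=
  [&& injectiveb v,
      [forall i, e0 :&: e i == [set v i]]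
    & [forall i, forall j, (i != j) ==> [disjoint e i & e j]]].

Definition crown_free (V : finType) (k : nat) (H : {set {set V}}) : bool :=
  ~~ [exists e0 in H, exists e : {ffun 'I_k -> {set V}},
        exists v : {ffun 'I_k -> V},
        [forall i, e i \in H] && crown e0 e v].

Definition ex_lin (r k n : nat) : nat :=
  \max_(H : {set {set 'I_n}} |
          [&& uniform r H, linear_hypergraph H & crown_free k H]) #|H|.

(* The quotient takes the value 0 at n = 0, as 0^-1 = 0; this does not affect
   the limsup. *)
Definition c_lin (R : realType) (r k : nat) : \bar R :=
  limn_esup (fun n : nat => ((ex_lin r k n)%:R / n%:R)%R%:E).

(* Main.v *)
Require Import Defs.
From mathcomp Require Import all_classical all_reals all_analysis.
From mathcomp Require Import all_boot all_order all_algebra.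
From mathcomp Require Import zify ring lra.
Set Implicit Arguments.
Unset Strict Implicit.
Unset Printing Implicit Defensive.
Import Order.TTheory GRing.Theory Num.Theory.

(** The bound is proved for every n, in the form |H| <= (t - c) n with an
    absolute constant c > 0, for a linear (q+1)-uniform hypergraph H without
    t+1 pairwise disjoint petals on a common base edge.

    Weights. Let every vertex x share a unit weight equally among its edges, so
    that an edge e receives the sum of 1 / deg x over x in e, and all edges
    together receive at most n ([sum_inv_deg]). Choosing petals greedily shows
    that every edge receives at least 1/t: either all its degrees are at most
    t q + 1, or it has a vertex of larger degree and then at most t of its
    vertices have degree above (t-1) q + 1 ([heavy_edge_few_large]). This gives
    |H| <= t n, with hardly any loss exactly on the balanced edges: those whose
    degrees are at most t q + 1 and, up to s (about q/1000) exceptions, larger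
    than t q - s. An unbalanced edge receives an extra weight of order 1/t^2
    ([inv_deg_edge]), so it suffices that unbalanced edges form a positive
    proportion of H ([many_unbalanced]).

    Structure. The configuration to exclude is one in which every edge lies in t
    projective planes of order q. Let e be balanced, with t disjoint petals on
    it. At a further saturated vertex x of e every edge meets some petal, while
    each petal is met by at most q edges at x; hence almost q edges at x meet a
    given petal l and no other one ([own_large]). Two such edges at different
    vertices of e must intersect, since otherwise they could replace l and give
    t+1 petals ([own_meet]). So the edges that own l behave like the lines of a
    projective plane through e. Fix y in e, and let L be the lines of this plane
    at y and Pi the others.

    Since t >= 2, there are about (t-1) q further edges at y. If most of
    them are balanced, a typical point x on them is joined to each line of L by
    almost q edges, so the t q edges at x meet q/t lines of L on average. But
    the lines of Pi have almost no point off L, and they already join almost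
    all pairs of points on distinct lines of L, so that the edges outside Pi
    cannot meet several lines of L often enough. The double count is
    [pencil_count], and its conclusion is that a saturated vertex of a balanced
    edge lies on many unbalanced edges ([many_unbalanced_at]). *)

(** * Finite counting *)

(** Counting by a relation that is total on A and injective towards A; it avoids
    naming the choice function. *)
Lemma leq_card_witness (T U : finType) (A : {set T}) (B : {set U})
    (r : T -> U -> bool) :
  (forall a, a \in A -> exists2 b, b \in B & r a b) ->
  (forall a a' b, a \in A -> a' \in A -> b \in B -> r a b -> r a' b -> a = a') ->
  #|A| <= #|B|.
Proof.
move=> ex_r inj_r.
have [-> | [a0 a0A]] := set_0Vmem A; first by rewrite cards0.
have [b0 _ _] := ex_r _ a0A.
pose h a := odflt b0 [pick b in B | r a b].
have hP a : a \in A -> h a \in B /\ r a (h a).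
  move=> aA; rewrite /h; case: pickP => [b /andP[] // | no].
  by have [b bB rab] := ex_r _ aA; have := no b; rewrite /= bB rab.
rewrite -(card_in_imset (f := h) (D := A)); last first.
  move=> a a' aA a'A hE; have [hB ra] := hP _ aA; have [_ ra'] := hP _ a'A.
  by apply: (inj_r a a' (h a)) => //; rewrite hE.
by apply/subset_leq_card/subsetP => _ /imsetP[a aA ->]; case: (hP _ aA).
Qed.

Lemma card_subset_exists (T : finType) (A : {set T}) n :
  n <= #|A| -> exists2 B : {set T}, B \subset A & #|B| = n.
Proof.
elim: n => [|n IHn] nA; first by exists set0; rewrite ?sub0set ?cards0.
have [B sBA Bn] := IHn (ltnW nA).
have /subsetPn[x xA xB] : ~~ (A \subset B).
  by apply: contraL nA => /subset_leq_card; rewrite Bn -leqNgt.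
by exists (x |: B); rewrite ?subUset ?sub1set ?xA // cardsU1 xB Bn.
Qed.

Lemma leq_card_bigcup (T : finType) (I : finType) (A : {set I}) (F : I -> {set T}) :
  #|\bigcup_(i in A) F i| <= \sum_(i in A) #|F i|.
Proof.
elim/big_rec2: _ => [|i n B _ IH]; first by rewrite cards0.
by rewrite cardsU (leq_trans (leq_subr _ _)) // leq_add2l.
Qed.

Lemma leq_card_bigcupM (T I : finType) (A : {set I}) (F : I -> {set T}) m :
  (forall i, i \in A -> #|F i| <= m) -> #|\bigcup_(i in A) F i| <= #|A| * m.
Proof.
move=> Fm; apply: leq_trans (leq_card_bigcup _ _) _.
by rewrite -sum_nat_const leq_sum.
Qed.

Lemma geq_card_bigcupM (T I : finType) (A : {set I}) (F : I -> {set T}) m :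
  (forall i j x, i \in A -> j \in A -> x \in F i -> x \in F j -> i = j) ->
  (forall i, i \in A -> m <= #|F i|) -> #|A| * m <= #|\bigcup_(i in A) F i|.
Proof.
move=> Fdisj Fm; have -> : \bigcup_(i in A) F i = \bigcup_i (if i \in A then F i else set0).
  by rewrite big_mkcond.
rewrite -sum_nat_const -[X in _ <= X]sum1_card partition_disjoint_bigcup.
  rewrite [X in X <= _]big_mkcond /=.
  apply: leq_sum => i _; case: ifP => iA; last by rewrite big_set0.
  by rewrite sum1_card Fm.
move=> i j; case: ifP => iA; case: ifP => jA; rewrite -?setI_eq0 ?set0I ?setI0 //.
apply: contraR => /set0Pn[x /setIP[xi xj]].
by apply/eqP; apply: (Fdisj i j x).
Qed.

Lemma cardsD1S (T : finType) (x : T) (A : {set T}) :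
  x \in A -> #|A| = #|A :\ x|.+1.
Proof. by move=> xA; rewrite (cardsD1 x) xA. Qed.

Lemma sum_indicator (T : finType) (A : {set T}) (P : pred T) :
  \sum_(x in A) (P x : nat) = #|[set x in A | P x]|.
Proof.
rewrite -sum1_card [RHS](eq_bigl (fun x => (x \in A) && P x)); last first.
  by move=> x; rewrite inE.
by rewrite [RHS]big_mkcondr; apply: eq_bigr => x _; case: (P x).
Qed.

(* Cardinals become variables first: equal ones may differ syntactically. *)
Ltac clia := repeat (let n := fresh "n" in set n := #|_|); lia.

(** The numerical end of the double count, with its unknowns as variables: F
    edges, X points, a pencil of L lines and a plane of Pi further lines. After
    division by t, the two sides compare as X q^2 against a small multiple of
    t q^4, while X is at least t q^2 / 8. *)
Lemma plane_count_absurd q t s F X L Pi d bad : 1 < t -> 1000 * s <= q -> 1000 * t <= q ->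
  t * q < d + s -> 8 * bad <= d -> d <= F + bad + q + 1 -> F * (q - s) <= X ->
  q <= L + s -> (q - (s + t)) * (q - s) <= Pi -> Pi <= q * q ->
  ~ 2 * t * (X * (L * (q - s))) <=
    2 * t * (Pi * (s.+1 * q)) + q * (X * (t * q)) + 8 * t * t * (q * q * (q * q - Pi)).
Proof.
move=> t2 sq tq dlow bad8 dup FX qL Pilow Piup H.
have t0 : 0 < t by lia.
have q0 : 0 < q by lia.
have tq2 : 2 * q <= t * q by rewrite leq_mul2r t2 orbT.
have F4 : t * q <= 4 * F by lia.
have X8 : t * q * q <= 8 * X.
  have : t * q * q <= 4 * F * (2 * (q - s)) by rewrite leq_mul //; lia.
  lia.
have P : q * q - Pi <= q * (2 * s + t).
  have : q * q <= (q - (s + t)) * (q - s) + q * (2 * s + t).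
    have [u ->] : exists u, q = u + s + t by exists (q - s - t); lia.
    have -> : u + s + t - (s + t) = u by lia.
    have -> : u + s + t - s = u + t by lia.
    nia.
  lia.
have {}H : X * (2 * (L * (q - s))) <=
    2 * (q * q * (s.+1 * q)) + q * q * X + 8 * t * (q * q * (q * (2 * s + t))).
  rewrite -(leq_pmul2l t0).
  have h1 : Pi * (s.+1 * q) <= q * q * (s.+1 * q) by rewrite leq_mul.
  have h2 : q * q * (q * q - Pi) <= q * q * (q * (2 * s + t)) by rewrite leq_mul.
  have := leq_mul (leqnn (2 * t)) h1; have := leq_mul (leqnn (8 * t * t)) h2.
  lia.
have LL : 19 * (q * q) <= 10 * (2 * (L * (q - s))).
  have h : (q - s) * (q - s) <= L * (q - s) by rewrite leq_mul //; lia.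
  have : 999 * q * (999 * q) <= (1000 * (q - s)) * (1000 * (q - s)) by rewrite leq_mul //; lia.
  lia.
have {}H : 9 * X <= q * (20 * s.+1 + 80 * t * (2 * s + t)).
  have h := leq_mul (leqnn X) LL.
  have qq0 : 0 < q * q by rewrite muln_gt0 q0.
  rewrite -(leq_pmul2l qq0); lia.
have {}H : 9 * (t * q) <= 8 * (20 * s.+1 + 80 * t * (2 * s + t)).
  rewrite -(leq_pmul2l q0); lia.
have h1 := leq_mul (leqnn t) sq.
have h2 := leq_mul (leqnn t) tq.
lia.
Qed.

(** * Petal systems *)

Section CrownFree.
Variables (V : finType) (H : {set {set V}}) (q t : nat).
Hypothesis unifH : forall e, e \in H -> #|e| = q.+1.
Hypothesis linH : forall e f x y,
  e \in H -> f \in H -> x \in e -> y \in e -> x \in f -> y \in f ->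
  x != y -> e = f.

Definition star (x : V) : {set {set V}} := [set g in H | x \in g].
Definition deg (x : V) : nat := #|star x|.

Lemma starP x g : reflect (g \in H /\ x \in g) (g \in star x).
Proof. by rewrite inE; apply: andP. Qed.

(** The petals on e as a set of edges: their feet need not be recorded, because
    disjoint petals have distinct feet. *)
Record petals (e : {set V}) (S : {set {set V}}) : Prop := Petals {
  petal_edge : forall f, f \in S -> f \in H;
  petal_neq : forall f, f \in S -> f != e;
  petal_foot : forall f, f \in S -> exists2 x, x \in e & x \in f;
  petal_disj : forall f g x, f \in S -> g \in S -> x \in f -> x \in g -> f = g }.

Hypothesis petals_bound : forall e S, e \in H -> petals e S -> #|S| <= t.

Definition hits (x : V) (e f : {set V}) : {set {set V}} :=
  [set g in star x :\ e | ~~ [disjoint g & f]].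

Lemma meetP (g f : {set V}) :
  reflect (exists2 p, p \in g & p \in f) (~~ [disjoint g & f]).
Proof.
rewrite -setI_eq0; apply: (iffP (set0Pn _)) => [[p /setIP[]]|[p pg pf]].
  by exists p.
by exists p; apply/setIP.
Qed.

Lemma card_edgeD1 e x : e \in H -> x \in e -> #|e :\ x| = q.
Proof. by move=> eH xe; have := cardsD1S xe; rewrite unifH // => -[]. Qed.

(** Each of the q points of f off e lies on at most one edge through x. *)
Lemma card_hits x e f : e \in H -> f \in H -> f != e -> x \in e -> x \notin f ->
  ~~ [disjoint e & f] -> #|hits x e f| <= q.
Proof.
move=> eH fH fe xe xf /meetP[u ue uf].
rewrite -(card_edgeD1 fH uf).
apply: (leq_card_witness (r := fun (g : {set V}) p => p \in g)) => [g|g g' p].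
  rewrite !inE => /andP[/and3P[ge gH xg] /meetP[p pg pf]].
  exists p => //; rewrite !inE pf andbT.
  apply: contraNneq ge => pu; apply/eqP.
  apply: (linH (x := x) (y := p)) => //; rewrite ?pu //.
  by apply: contraNneq xf => ->.
rewrite !inE => /andP[/and3P[_ gH xg] _] /andP[/and3P[_ gH' xg'] _].
move=> /andP[_ pf] pg pg'; apply: (linH (x := x) (y := p)) => //.
by apply: contraNneq xf => ->.
Qed.

Lemma petals0 e : petals e set0.
Proof. by split=> [f|f|f|f g x]; rewrite inE. Qed.

Lemma petalsU1 e S g x : petals e S -> g \in H -> g != e -> x \in e -> x \in g ->
  (forall f, f \in S -> [disjoint g & f]) -> petals e (g |: S).
Proof.
move=> [SH Se Sft Sdj] gH ge xe xg gS; split.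
- by move=> f /setU1P[->|/SH].
- by move=> f /setU1P[->|/Se].
- by move=> f /setU1P[->|/Sft //]; exists x.
- move=> f f' p /setU1P[->|fS] /setU1P[->|f'S] // pf pf'; last exact: (Sdj f f' p).
  + by have /disjointFr/(_ pf) := gS _ f'S; rewrite pf'.
  + by have /disjointFr/(_ pf') := gS _ fS; rewrite pf.
Qed.

(** Greedy choice: j petals have q j points off e, and each of them spoils
    at most one of the edges at the next foot. *)
Lemma extend_petals e S (X : {set V}) : e \in H -> petals e S -> X \subset e ->
  (forall x f, x \in X -> f \in S -> x \notin f) ->
  (forall x, x \in X -> (#|S| + #|X|).-1 * q + 2 <= deg x) ->
  exists S', [/\ petals e S', S \subset S', #|S'| = #|S| + #|X| &
    forall f x, f \in S' -> x \in e -> x \in f -> f \in S \/ x \in X].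
Proof.
move=> eH; move: {2}#|X| (erefl #|X|) => n; elim: n X S => [|n IHn] X S cX pS sXe XS Xdeg.
  by exists S; split=> //; [rewrite cX addn0 | move=> f x; left].
have [x xX] : exists x, x \in X by apply/set0Pn; rewrite -card_gt0 cX.
have xe : x \in e by apply: (subsetP sXe).
have [g gx gS] : exists2 g, g \in star x :\ e & g \notin \bigcup_(f in S) hits x e f.
  apply/subsetPn; apply: contraTN (Xdeg x xX) => /subset_leq_card le_dS.
  have exs : e \in star x by apply/starP.
  have := cardsD1S exs; rewrite -/(deg x) => degx.
  have : #|\bigcup_(f in S) hits x e f| <= #|S| * q.
    apply: leq_card_bigcupM => f fS.
    have [u ue uf] := petal_foot pS fS.
    by apply: card_hits => //;
      rewrite ?(petal_edge pS) ?(petal_neq pS) ?XS //; apply/meetP; exists u.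
  rewrite cX (addnS #|S|) -ltnNge /= mulnDl => cup; move: degx cup le_dS; clia.
move: gx; rewrite !inE => /and3P[ge gH xg].
have gSd f : f \in S -> [disjoint g & f].
  move=> fS; apply: contraNT gS => gf; apply/bigcupP; exists f => //.
  by rewrite !inE ge gH xg.
have gNS : g \notin S by apply/negP => gS'; have := XS _ _ xX gS'; rewrite xg.
have cX' : #|X :\ x| = n by have := cardsD1 x X; rewrite xX cX => -[].
have ge1 z : z \in e -> z \in g -> z = x.
  move=> ze zg; apply: contraNeq ge => zx; apply/eqP.
  by apply: (linH (x := z) (y := x)).
have [||||S' [pS' sSS' cS' S'ft]] := IHn (X :\ x) (g |: S) cX'.
- exact: (petalsU1 (x := x)).
- by apply: subset_trans sXe; rewrite subsetDl.
- move=> z f /setD1P[zx zX] /setU1P[->|fS]; last exact: XS.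
  by apply: contraNN zx => zg; apply/eqP/ge1 => //; apply: (subsetP sXe).
- move=> z /setD1P[_ zX]; apply: leq_trans (Xdeg _ zX).
  by rewrite cardsU1 gNS cX' cX (addnS #|S|).
exists S'; split=> //.
- by apply: subset_trans sSS'; rewrite subsetUr.
- by rewrite cS' cX' cX cardsU1 gNS addnS.
- move=> f z fS' ze zf; case: (S'ft f z fS' ze zf) => [/setU1P[E|]|/setD1P[_]]; auto.
  by right; rewrite (ge1 z) // -E.
Qed.

Hypothesis t_gt0 : 0 < t.

(** Otherwise t petals can be placed away from v on vertices of large degree, and
    the degree of v still leaves room for one more. *)
Lemma heavy_edge_few_large e v : e \in H -> v \in e -> t * q + 2 <= deg v ->
  #|[set x in e | t.-1 * q + 2 <= deg x]| <= t.
Proof.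
move=> eH ve dv; rewrite leqNgt; apply/negP => big.
set A := [set x in e | _] in big.
have tA : t <= #|A :\ v| by have := cardsD1 v A; case: (v \in A) => /=; lia.
have [X sXA cX] := card_subset_exists tA.
have XP x : x \in X -> [/\ x != v, x \in e & t.-1 * q + 2 <= deg x].
  by move=> /(subsetP sXA); rewrite !inE => /and3P[].
have sXe : X \subset e by apply/subsetP => x /XP[].
have [|x xX|S [pS _ cS Sft]] := @extend_petals e set0 X eH (petals0 e) sXe.
- by move=> x f; rewrite inE.
- by rewrite cards0 cX; case: (XP _ xX).
have vS x f : x \in [set v] -> f \in S -> x \notin f.
  move=> /set1P-> fS; apply/negP => vf; case: (Sft f v fS ve vf) => [|/XP[]].
  - by rewrite inE.
  - by rewrite eqxx.
have sve : [set v] \subset e by rewrite sub1set.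
have [x /set1P->|S' [pS' _ cS' _]] := extend_petals eH pS sve vS.
- by rewrite cS cards0 cX cards1 add0n addn1.
have := petals_bound eH pS'; rewrite cS' cS cards0 cX cards1; lia.
Qed.

(** The edges at x that meet l and no other petal of S. In the model of t
    projective planes through e they are the lines through x of the plane
    spanned by e and l. *)
Definition own (x : V) (e : {set V}) (S : {set {set V}}) (l : {set V}) :
    {set {set V}} :=
  [set g in hits x e l | [forall f in S, (f != l) ==> [disjoint g & f]]].

Lemma ownP x e (S : {set {set V}}) (l : {set V}) g : reflect
  [/\ g \in H, g != e, x \in g, ~~ [disjoint g & l] &
      forall f, f \in S -> f != l -> [disjoint g & f]] (g \in own x e S l).
Proof.
rewrite !inE; apply: (iffP andP).
  by case=> /andP[/and3P[-> -> ->] ->] /forall_inP F; split=> // f /F /implyP.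
case=> -> -> -> -> F; split=> //; apply/forall_inP => f fS.
by apply/implyP; apply: F.
Qed.

Lemma own_sub_hits x e S l : own x e S l \subset hits x e l.
Proof. by apply/subsetP => g; rewrite inE => /andP[]. Qed.

(** All edges at x meet a petal by maximality of S, and the t - 1 petals other
    than l account for at most q of them each. *)
Lemma card_own_lower x e S l : e \in H -> petals e S -> #|S| = t -> l \in S ->
  x \in e -> (forall f, f \in S -> x \notin f) ->
  deg x <= #|own x e S l| + t.-1 * q + 1.
Proof.
move=> eH pS cS lS xe xS.
have exs : e \in star x by apply/starP.
have := cardsD1S exs; rewrite -/(deg x) => degx.
have sub : star x :\ e \subset own x e S l :|: \bigcup_(f in S :\ l) hits x e f.
  apply/subsetP => g gx; rewrite in_setU.
  have [//|/= gB] := boolP (g \in \bigcup_(f in S :\ l) hits x e f).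
    by rewrite orbT.
  move: (gx); rewrite !in_setD1 in_set => /and3P[ge gH xg]; rewrite orbF.
  have gd f : f \in S -> f != l -> [disjoint g & f].
    move=> fS fl; apply: contraNT gB => gf; apply/bigcupP; exists f.
      by rewrite !inE fl.
    by rewrite !inE ge gH xg.
  apply/ownP; split=> //; apply/negP => gl.
  have gNS : g \notin S by apply/negP => gS; have := xS _ gS; rewrite xg.
  have : petals e (g |: S).
    apply: (petalsU1 (x := x)) => // f fS; have [->//|fl] := eqVneq f l.
    exact: gd.
  by move/(petals_bound eH); rewrite cardsU1 gNS cS ltnn.
have := subset_leq_card sub.
have [+ _] := leq_card_setU (own x e S l) (\bigcup_(f in S :\ l) hits x e f).
have cSl : #|S :\ l| = t.-1 by have := cardsD1S lS; rewrite cS => ->.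
have : #|\bigcup_(f in S :\ l) hits x e f| <= #|S :\ l| * q.
  apply: leq_card_bigcupM => f /setD1P[_ fS].
  have [u ue uf] := petal_foot pS fS.
  by apply: card_hits => //;
    rewrite ?(petal_edge pS) ?(petal_neq pS) ?xS //; apply/meetP; exists u.
rewrite cSl; move: degx; clia.
Qed.

Lemma card_own_upper x e S l : e \in H -> petals e S -> l \in S ->
  x \in e -> (forall f, f \in S -> x \notin f) -> #|own x e S l| <= q.
Proof.
move=> eH pS lS xe xS; apply: leq_trans (subset_leq_card (own_sub_hits x e S l)) _.
have [u ue uf] := petal_foot pS lS.
by apply: card_hits => //;
    rewrite ?(petal_edge pS) ?(petal_neq pS) ?xS //; apply/meetP; exists u.
Qed.

Lemma edge_meet_uniq e g x z : e \in H -> g \in H -> g != e -> x \in e -> x \in g ->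
  z \in e -> z \in g -> z = x.
Proof.
move=> eH gH ge xe xg ze zg; apply: contraNeq ge => zx; apply/eqP.
exact: (linH (x := z) (y := x)).
Qed.

(** If g and g' were disjoint, trading l for both of them would give t + 1
    petals. *)
Lemma own_meet x x' e S l g g' : e \in H -> petals e S -> #|S| = t -> l \in S ->
  x \in e -> x' \in e -> x != x' ->
  (forall f, f \in S -> x \notin f) -> (forall f, f \in S -> x' \notin f) ->
  g \in own x e S l -> g' \in own x' e S l -> ~~ [disjoint g & g'].
Proof.
move=> eH pS cS lS xe xe' xx' xS xS' /ownP[gH ge xg gl gd] /ownP[gH' ge' xg' gl' gd'].
apply/negP => gg'.
have pS1 : petals e (S :\ l).
  have [SH Se Sft Sdj] := pS.
  by split=> [f|f|f|f f' z]; rewrite !inE => /andP[_ fS] //;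
    [exact: SH|exact: Se|exact: Sft|move=> /andP[_ fS'] zf zf'; exact: (Sdj f f' z)].
have pS2 : petals e (g' |: (S :\ l)).
  by apply: (petalsU1 (x := x')) => // f /setD1P[fl fS]; apply: gd'.
have : petals e (g |: (g' |: (S :\ l))).
  by apply: (petalsU1 (x := x)) => // f /setU1P[->//|/setD1P[fl fS]]; apply: gd.
move/(petals_bound eH); rewrite !cardsU1 !inE.
have gS : g \notin S by apply/negP => gS; have := xS _ gS; rewrite xg.
have gS' : g' \notin S by apply/negP => gS'; have := xS' _ gS'; rewrite xg'.
have gNg' : g != g'.
  apply: contraNneq xx' => E; apply/eqP.
  by apply: (edge_meet_uniq (e := e) (g := g')) => //; rewrite -E.
rewrite (negPf gNg') (negPf gS) (negPf gS') !andbF /= !add1n.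
by have := cardsD1S lS; rewrite cS => <-; rewrite ltnn.
Qed.

(** Any edge meeting e extends to a full petal system that avoids x. *)
Lemma petal_system e v l x : e \in H -> v \in e -> l \in H -> l != e -> v \in l ->
  x \in e -> x != v -> t < #|[set z in e | t.-1 * q + 2 <= deg z]| ->
  exists S, [/\ petals e S, #|S| = t, l \in S & forall f, f \in S -> x \notin f].
Proof.
move=> eH ve lH le vl xe xv big; set A := [set z in e | _] in big.
have tA : t.-1 <= #|A :\ v :\ x|.
  have := cardsD1 v A; have := cardsD1 x (A :\ v).
  case: (v \in A) => /=; case: (x \in _) => /=; lia.
have [X sXA cX] := card_subset_exists tA.
have XP z : z \in X -> [/\ z != x, z != v, z \in e & t.-1 * q + 2 <= deg z].
  by move=> /(subsetP sXA); rewrite !inE => /and4P[].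
have sXe : X \subset e by apply/subsetP => z /XP[].
have pl : petals e [set l].
  rewrite -(setU0 [set l]); apply: (petalsU1 (x := v)) => //; first exact: petals0.
  by move=> f; rewrite inE.
have lNe z : z \in e -> z != v -> z \notin l.
  by move=> ze zv; apply: contraNN zv => zl; apply/eqP/(edge_meet_uniq (e := e) (g := l)).
have [z f /XP[_ zv ze _] /set1P->|z zX|S [pS sS cS Sft]] := extend_petals eH pl sXe.
- exact: lNe.
- by rewrite cards1 cX; case: (XP _ zX).
exists S; split=> //.
- by rewrite cS cards1 cX add1n prednK.
- by apply: (subsetP sS); rewrite inE.
move=> f fS; apply/negP => xf; case: (Sft f x fS xe xf) => [/set1P E|/XP[]].
  by have := lNe _ xe xv; rewrite -E xf.
by rewrite eqxx.
Qed.

(** * Counting incidences with a pencil of lines *)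

Definition touch (L : {set {set V}}) (g : {set V}) : nat :=
  #|[set l in L | ~~ [disjoint g & l]]|.

(** Distinct lines through y are met in distinct points of g. *)
Lemma touch_setI y (L : {set {set V}}) (X g : {set V}) :
  L \subset star y -> g \in H -> y \notin g ->
  (forall x l, x \in X -> l \in L -> x \notin l) ->
  touch L g + #|g :&: X| <= q.+1.
Proof.
move=> Ly gH yg XL; rewrite -(unifH gH) -(cardsID X g) addnC leq_add2l.
have LP l : l \in L -> l \in H /\ y \in l by move=> /(subsetP Ly)/starP.
apply: (leq_card_witness (r := fun (l : {set V}) p => p \in l)) => [l|l l' p].
  rewrite inE => /andP[lL /meetP[p pg pl]]; exists p => //.
  by rewrite inE pg andbT; apply: contraL pl => /XL; apply.
rewrite !inE => /andP[/LP[lH yl] _] /andP[/LP[lH' yl'] _] /andP[_ pg] pl pl'.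
by apply: (linH (x := y) (y := p)) => //; apply: contraNneq yg => ->.
Qed.

(** Such an edge is determined by the two points where it meets l and l'. *)
Lemma card_joining y (l l' : {set V}) : l \in star y -> l' \in star y -> l != l' ->
  #|[set g in H | [&& y \notin g, ~~ [disjoint g & l] & ~~ [disjoint g & l']]]| <= q * q.
Proof.
move=> /starP[lH yl] /starP[lH' yl'] ll'.
have -> : q * q = #|setX (l :\ y) (l' :\ y)|.
  by rewrite cardsX (card_edgeD1 lH yl) (card_edgeD1 lH' yl').
apply: (leq_card_witness (r := fun (g : {set V}) p => (p.1 \in g) && (p.2 \in g))).
  move=> g; rewrite inE => /and4P[gH yg /meetP[p pg pl] /meetP[p' pg' pl']].
  exists (p, p'); last by rewrite /= pg.
  rewrite !inE /= pl pl' !andbT.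
  by apply/andP; split; apply: contraNneq yg => <-.
move=> g g' [p p']; rewrite !inE /= => /andP[gH _] /andP[gH' _].
move=> /andP[/andP[py pl] /andP[py' pl']] /andP[pg pg'] /andP[pg2 pg2'].
apply: (linH (x := p) (y := p')) => //; apply: contraNneq ll' => pp'.
by apply/eqP; apply: (linH (x := y) (y := p)) => //; rewrite ?pp' // eq_sym -pp'.
Qed.

(** Ordered pairs of distinct lines of L met by g. *)
Lemma touch_pairs (L : {set {set V}}) (g : {set V}) : touch L g * (touch L g).-1 =
  \sum_(l in L) \sum_(l' in L :\ l)
     (~~ [disjoint g & l] && ~~ [disjoint g & l'] : nat).
Proof.
rewrite {1}/touch -sum_indicator big_distrl /=; apply: eq_bigr => l lL.
case: (boolP (~~ [disjoint g & l])) => gl /=; last by rewrite big1.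
rewrite mul1n sum_indicator /touch [in LHS](@cardsD1S _ l) ?inE ?lL //=.
by apply: eq_card => l'; rewrite !inE andbA.
Qed.

(** A linear substitute for convexity: an edge with a points in X that meets b
    lines of the pencil has b <= q / 2t, or else b^2 dominates a b. *)
Lemma product_split_bound a b : 4 * t <= q -> b + a <= q.+1 ->
  2 * t * (a * b) <= q * a + 8 * t * t * (b * b.-1).
Proof.
move=> tq ab; have [small|large] := leqP (2 * t * b) q.
  by apply: leq_trans (leq_addr _ _); rewrite [a * b]mulnC mulnA leq_mul.
have b_gt2 : 2 < b by nia.
apply: leq_trans (leq_addl _ _).
have -> : 8 * t * t * (b * b.-1) = 2 * t * (2 * t * b * (2 * b.-1)) by lia.
rewrite leq_mul // [a * b]mulnC mulnC leq_mul //; lia.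
Qed.

(** Both sides estimate, up to the factor 2 t, the number of triples (x, g, l)
    with x in X, g an edge through x off y, and l a line of L met by g. From
    below, every x is joined to every l by q - s edges. From above, an edge of
    Pi has at most s + 1 points in X; for the other edges [product_split_bound]
    leaves the number of incidences with X and the number of pairs of lines
    that they meet, and Pi uses up most of the q^2 joins of each such pair. *)
Lemma pencil_count s y (L Pi : {set {set V}}) (X : {set V}) :
  4 * t <= q -> L \subset star y -> #|L| <= q -> q <= #|L| + s ->
  (forall g, g \in Pi ->
     [/\ g \in H, y \notin g & forall l, l \in L -> ~~ [disjoint g & l]]) ->
  (forall x, x \in X -> deg x <= (t * q).+1) ->
  (forall x, x \in X -> exists f, [/\ f \in star x, f \in star y, f \notin L, x != y &
     forall l, l \in L -> q <= #|hits x f l| + s]) ->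
  2 * t * (#|X| * (#|L| * (q - s))) <=
  2 * t * (#|Pi| * (s.+1 * q)) + q * (#|X| * (t * q)) +
  8 * t * t * (q * q * (q * q - #|Pi|)).
Proof.
move=> tq Ly Lq qL PiP degX XP.
pose N := [set g in H | y \notin g].
have NP g : g \in N -> g \in H /\ y \notin g by rewrite inE => /andP.
have XL x l : x \in X -> l \in L -> x \notin l.
  move=> xX lL; have [f [/starP[fH xf] /starP[_ yf] fL xy _]] := XP _ xX.
  have /starP[lH yl] := subsetP Ly _ lL.
  by apply: contraNN fL => xl; rewrite (linH (x := x) (y := y) (e := f) (f := l)).
(* Each x of X is joined to each line of L by q - s edges. *)
have lower : #|X| * (#|L| * (q - s)) <= \sum_(g in N) #|g :&: X| * touch L g.
  have -> : \sum_(g in N) #|g :&: X| * touch L g =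
      \sum_(x in X) \sum_(g in N) (x \in g) * touch L g.
    rewrite exchange_big /=; apply: eq_bigr => g _.
    rewrite -big_distrl /= sum_indicator; congr (_ * _).
    by apply: eq_card => x; rewrite !inE andbC.
  rewrite -sum_nat_const; apply: leq_sum => x xX.
  have [f [/starP[fH xf] /starP[_ yf] fL xy hf]] := XP _ xX.
  have -> : \sum_(g in N) (x \in g) * touch L g =
      \sum_(l in L) \sum_(g in N) ((x \in g) && ~~ [disjoint g & l] : nat).
    rewrite exchange_big /=; apply: eq_bigr => g _.
    rewrite /touch -sum_indicator big_distrr /=; apply: eq_bigr => l _.
    by rewrite mulnb.
  rewrite -sum_nat_const; apply: leq_sum => l lL; rewrite sum_indicator.
  rewrite leq_subLR addnC; apply: leq_trans (hf _ lL) _; rewrite leq_add2r.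
  apply/subset_leq_card/subsetP => g; rewrite !inE => /andP[/and3P[gf gH xg] gl].
  rewrite gH xg gl !andbT /=; apply: contraNN gf => yg.
  by apply/eqP; apply: (linH (x := x) (y := y)).
(* Each x of X has at most t q edges off y. *)
have upper : \sum_(g in N) #|g :&: X| <= #|X| * (t * q).
  have -> : \sum_(g in N) #|g :&: X| = \sum_(x in X) \sum_(g in N) (x \in g : nat).
    rewrite exchange_big /=; apply: eq_bigr => g _; rewrite sum_indicator.
    by apply: eq_card => x; rewrite !inE andbC.
  rewrite -sum_nat_const; apply: leq_sum => x xX; rewrite sum_indicator.
  have [f [fx /starP[_ yf] _ _ _]] := XP _ xX.
  rewrite -ltnS; apply: leq_trans (degX _ xX); rewrite /deg (cardsD1S fx) ltnS.
  apply/subset_leq_card/subsetP => g; rewrite !inE => /andP[/andP[gH yg] xg].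
  by rewrite gH xg !andbT; apply: contraNneq yg => ->.
(* Two lines of L have at most q^2 joins, and those in Pi join every pair. *)
have pairs : \sum_(g in N :\: Pi) touch L g * (touch L g).-1 <=
    q * q * (q * q - #|Pi|).
  rewrite (eq_bigr _ (fun g _ => touch_pairs L g)) exchange_big /=.
  apply: (@leq_trans (\sum_(l in L) \sum_(l' in L) (q * q - #|Pi|))); last first.
    by rewrite !sum_nat_const mulnA leq_mul // leq_mul.
  apply: leq_sum => l lL; rewrite exchange_big /= [X in _ <= X](big_setD1 l) //=.
  rewrite -[X in X <= _]add0n leq_add // leq_sum // => l' /setD1P[ll' lL'].
  have joinl := card_joining (subsetP Ly _ lL) (subsetP Ly _ lL').
  rewrite sum_indicator; apply: leq_trans (leq_sub2r #|Pi| (joinl _)); last first.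
    by rewrite eq_sym.
  set J := [set g in H | _]; have PiJ : Pi \subset J.
    by apply/subsetP => g /PiP[gH yg gL]; rewrite inE gH yg !gL.
  rewrite -(cardsDS PiJ); apply/subset_leq_card/subsetP => g; rewrite !inE.
  by case/andP=> /and3P[-> -> ->] ->.
have cap g : g \in N -> touch L g + #|g :&: X| <= q.+1.
  by move=> /NP[gH yg]; apply: (touch_setI Ly).
have inPi : \sum_(g in N :&: Pi) #|g :&: X| * touch L g <= #|Pi| * (s.+1 * q).
  rewrite -sum_nat_const big_mkcond [X in _ <= X]big_mkcond /=.
  apply: leq_sum => g _; rewrite inE; case: (boolP (g \in Pi)) => gPi; rewrite ?andbF // andbT.
  case: ifP => // gN; have [gH yg gL] := PiP _ gPi.
  have tL : touch L g = #|L|.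
    rewrite /touch; apply: eq_card => l; rewrite inE.
    by case: (boolP (l \in L)) => //= lL; apply: gL.
  by rewrite leq_mul //; have := cap g gN; rewrite tL //; lia.
have offPi : 2 * t * (\sum_(g in N :\: Pi) #|g :&: X| * touch L g) <=
    q * (\sum_(g in N :\: Pi) #|g :&: X|) +
    8 * t * t * (\sum_(g in N :\: Pi) touch L g * (touch L g).-1).
  rewrite !big_distrr /= -big_split /=; apply: leq_sum => g /setDP[gN _].
  by rewrite product_split_bound // cap.
rewrite (big_setID Pi) /= in lower.
have offX : \sum_(g in N :\: Pi) #|g :&: X| <= #|X| * (t * q).
  by apply: leq_trans upper; rewrite [X in _ <= X](big_setID Pi) leq_addl.
apply: (leq_trans (leq_mul (leqnn (2 * t)) lower)).
rewrite mulnDr -addnA leq_add // ?leq_mul //.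
apply: leq_trans offPi _.
by rewrite leq_add // leq_mul.
Qed.

(** * Balanced edges *)

Variable s : nat.
Definition saturated (x : V) : bool := t * q < deg x + s.
Definition balanced (e : {set V}) : bool :=
  [forall x in e, deg x <= (t * q).+1] &&
  (#|[set x in e | ~~ saturated x]| <= s).

Hypothesis t_gt1 : 1 < t.
Hypothesis s_small : 1000 * s <= q.
Hypothesis t_small : 1000 * t <= q.

Lemma card_saturated e : e \in H -> balanced e ->
  q.+1 <= #|[set x in e | saturated x]| + s.
Proof.
move=> eH /andP[_ few]; rewrite -(unifH eH).
apply: leq_trans (leq_add (leqnn _) few); apply: leq_trans (leq_card_setU _ _).1.
by apply/subset_leq_card/subsetP => x xe; rewrite !inE xe; case: saturated.
Qed.

Let mulq : t * q = t.-1 * q + q.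
Proof. by rewrite -mulSnr prednK. Qed.

Lemma balanced_many_large e : e \in H -> balanced e ->
  t < #|[set z in e | t.-1 * q + 2 <= deg z]|.
Proof.
move=> eH be; have := card_saturated eH be => many.
apply: (@leq_trans #|[set x in e | saturated x]|); first by clia.
apply/subset_leq_card/subsetP => x; rewrite !inE => /andP[-> /=].
by rewrite /saturated mulq; lia.
Qed.

(** A petal is owned by almost q edges at each saturated vertex. *)
Lemma own_large x e S l : e \in H -> petals e S -> #|S| = t -> l \in S ->
  x \in e -> (forall f, f \in S -> x \notin f) -> saturated x ->
  q <= #|own x e S l| + s.
Proof.
move=> eH pS cS lS xe xS; rewrite /saturated.
have := card_own_lower eH pS cS lS xe xS.
by rewrite mulq; clia.
Qed.

(** Any petal system on e that contains l and avoids x shows this, as l then owns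
    almost q edges at x. *)
Lemma hits_large e v x l : e \in H -> balanced e -> v \in e -> l \in star v ->
  l != e -> x \in e -> x != v -> saturated x -> q <= #|hits x e l| + s.
Proof.
move=> eH be ve /starP[lH vl] le xe xv satx.
have [S [pS cS lS xS]] := petal_system eH ve lH le vl xe xv (balanced_many_large eH be).
apply: leq_trans (own_large eH pS cS lS xe xS satx) _.
by rewrite leq_add2r subset_leq_card // own_sub_hits.
Qed.

(** If most edges at y were balanced, the plane L, Pi through e and the points X
    of the balanced edges at y outside that plane would contradict
    [pencil_count]. *)
Lemma many_unbalanced_at e y : e \in H -> balanced e -> y \in e -> saturated y ->
  deg y < 8 * #|[set f in star y | ~~ balanced f]|.
Proof.
move=> eH be ye saty; rewrite ltnNge; apply/negP => few_bad.
have satdeg x : saturated x -> 2 <= deg x by rewrite /saturated; nia.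
have [v] : exists v, v \in [set x in e | saturated x] :\ y.
  apply/set0Pn; rewrite -card_gt0.
  have := card_saturated eH be; rewrite (cardsD1 y); case: (y \in _) => /=; clia.
rewrite !inE => /and3P[vy ve satv].
have [l] : exists l, l \in star v :\ e.
  apply/set0Pn; rewrite -card_gt0; have := satdeg _ satv.
  by rewrite /deg (@cardsD1S _ e) //; apply/starP.
rewrite !inE => /and3P[le lH vl].
have yv : y != v by rewrite eq_sym.
have [S [pS cS lS yS]] := petal_system eH ve lH le vl ye yv (balanced_many_large eH be).
pose W := [set w in e | saturated w && [forall f in S, w \notin f]].
have WP w : w \in W -> [/\ w \in e, saturated w & forall f, f \in S -> w \notin f].
  by rewrite inE => /and3P[-> -> /forall_inP].
have yW : y \in W by rewrite inE ye saty; apply/forall_inP.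
(* All but s + t vertices of e are saturated and off the petals. *)
have cW : q.+1 <= #|W| + (s + t).
  have sub : e \subset W :|: ([set x in e | ~~ saturated x] :|: \bigcup_(f in S) (e :&: f)).
    apply/subsetP => x xe; rewrite !in_setU !in_set xe /=.
    case: (boolP (saturated x)) => //= _; case: (boolP [forall f in S, x \notin f]) => //=.
    rewrite negb_forall_in => /exists_inP[f fS /negPn xf].
    by apply/bigcupP; exists f => //; rewrite inE xe.
  rewrite -(unifH eH); apply: leq_trans (subset_leq_card sub) _.
  apply: leq_trans (leq_card_setU _ _).1 _; rewrite leq_add2l.
  apply: leq_trans (leq_card_setU _ _).1 _; apply: leq_add; first by case/andP: be.
  rewrite -cS -[#|S|]muln1; apply: leq_card_bigcupM => f fS.
  have [u ue uf] := petal_foot pS fS.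
  rewrite -(cards1 u); apply/subset_leq_card/subsetP => z /setIP[ze zf].
  by apply/set1P; apply: (edge_meet_uniq (e := e) (g := f)) => //;
    [exact: petal_edge pS _ fS | exact: petal_neq pS _ fS].
pose L := own y e S l.
pose Pi := \bigcup_(w in W :\ y) own w e S l.
have Ly : L \subset star y by apply/subsetP => g /ownP[gH _ yg _ _]; apply/starP.
have Lq : #|L| <= q by apply: card_own_upper.
have qL : q <= #|L| + s by apply: own_large.
have PiP g : g \in Pi ->
    [/\ g \in H, y \notin g & forall l, l \in L -> ~~ [disjoint g & l]].
  case/bigcupP=> w /setD1P[wy /WP[we satw wS]] gw.
  have /ownP[gH ge wg _ _] := gw; split=> //.
    apply: contraNN wy => yg; rewrite eq_sym; apply/eqP.
    by apply: (edge_meet_uniq (e := e) (g := g)).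
  by move=> l' l'L; apply: (own_meet (x := w) (x' := y) eH pS cS lS).
have cWy : #|W| = #|W :\ y|.+1 by apply: cardsD1S.
have Pilow : (q - (s + t)) * (q - s) <= #|Pi|.
  apply: (@leq_trans (#|W :\ y| * (q - s))); first by
    rewrite leq_mul2r leq_subLR addnC -ltnS -addSn -cWy cW orbT.
  apply: geq_card_bigcupM => [w w' g|w] /setD1P[_ /WP[we satw wS]].
    move=> /setD1P[_ /WP[we' _ _]] /ownP[gH ge wg _ _] /ownP[_ _ wg' _ _].
    by apply: (edge_meet_uniq (e := e) (g := g)).
  by rewrite leq_subLR addnC; apply: own_large.
have Piup : #|Pi| <= q * q.
  apply: (@leq_trans (#|W :\ y| * q)).
    apply: leq_card_bigcupM => w /setD1P[_ /WP[we satw wS]].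
    exact: card_own_upper.
  rewrite leq_mul2r -ltnS -cWy -(unifH eH) subset_leq_card ?orbT //.
  by apply/subsetP => w /WP[].
pose F := [set f in star y | balanced f] :\: (e |: L).
have FP f : f \in F -> [/\ f \in H, y \in f, balanced f, f != e & f \notin L].
  rewrite in_setD in_setU1 negb_or in_set.
  by case/andP=> /andP[fe fL] /andP[/starP[fH yf] bf].
pose X := \bigcup_(f in F) [set x in f | saturated x && (x != y)].
have XP x : x \in X -> exists2 f, f \in F & [/\ x \in f, saturated x & x != y].
  by case/bigcupP=> f fF; rewrite inE => /and3P[xf sx xy]; exists f.
have FX : #|F| * (q - s) <= #|X|.
  apply: geq_card_bigcupM => [f f' x|f] /FP[fH yf bf fe fL].
    move=> /FP[fH' yf' _ _ _]; rewrite !inE => /and3P[xf _ xy] /and3P[xf' _ _].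
    exact: (linH (x := x) (y := y)).
  have := card_saturated fH bf.
  have : #|[set x in f | saturated x]| <= #|[set x in f | saturated x && (x != y)]|.+1.
    rewrite (cardsD1 y) -add1n leq_add ?leq_b1 //.
    by apply/subset_leq_card/subsetP => x; rewrite !inE => /and3P[-> -> ->].
  by move=> h1 h2; rewrite leq_subLR addnC -ltnS -addSn (leq_trans h2) // leq_add2r.
(* Edges at y: in F, unbalanced, in L, or e itself. *)
have cF : deg y <= #|F| + #|[set f in star y | ~~ balanced f]| + q + 1.
  have sub : star y \subset F :|: [set f in star y | ~~ balanced f] :|: L :|: [set e].
    apply/subsetP => f /starP[fH yf]; rewrite !in_setU in_setD in_setU1 in_set1.
    case: (f \in L); case: (f == e); rewrite /= ?orbT // !in_set fH yf /= !orbF.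
    exact: orbN.
  rewrite /deg; apply: leq_trans (subset_leq_card sub) _.
  apply: leq_trans (leq_card_setU _ _).1 _; rewrite cards1 leq_add2r.
  apply: leq_trans (leq_card_setU _ _).1 _; rewrite leq_add //.
  exact: (leq_card_setU _ _).1.
apply: (plane_count_absurd t_gt1 s_small t_small saty few_bad cF FX qL Pilow Piup).
have t4 : 4 * t <= q by apply: leq_trans t_small; rewrite leq_mul2r orbT.
apply: (pencil_count t4 Ly Lq qL PiP) => [|x /XP[f /FP[fH yf bf fe fL] [xf satx xy]]].
  by move=> x /XP[f /FP[_ _ /andP[/forall_inP degf _] _ _] [xf _ _]]; apply: degf.
exists f; split=> //; [exact/starP|exact/starP|] => l' l'L.
apply: (hits_large (v := y)) => //; first exact: (subsetP Ly).
by apply: contraNneq fL => <-.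
Qed.

End CrownFree.

(** * Weights *)

Local Open Scope ring_scope.

(** The weight 1/d given by a vertex of degree d <= M - s, compared with
    the least weight 1/(M+1) given by the vertices of a balanced edge. *)
Lemma inv_gap (R : realFieldType) (d M s : R) :
  0 < d -> 1 <= M -> 0 <= s -> d + s <= M -> (M + 1)^-1 + s / (2 * M ^+ 2) <= d^-1.
Proof.
move=> d0 M1 s0 dM.
have -> : (M + 1)^-1 + s / (2 * M ^+ 2) =
    (2 * M ^+ 2 + s * (M + 1)) / (2 * M ^+ 2 * (M + 1)).
  by field; rewrite !gt_eqF //; lra.
rewrite ler_pdivrMr; last by rewrite !mulr_gt0 ?exprn_gt0 //; lra.
rewrite ler_pdivlMl // mulrC.
have h : (2 * M ^+ 2 + s * (M + 1)) * d <= (2 * M ^+ 2 + s * (M + 1)) * (M - s).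
  by rewrite ler_wpM2l //; nra.
apply: le_trans h _; nra.
Qed.

(** The excess of S deficient vertices, each as in [inv_gap] with
    M = T Q: the ratio S / Q is at least 1 / N. *)
Lemma light_gap (R : realFieldType) (N S Q T : R) :
  0 < N -> 0 < S -> 0 < Q -> 0 < T -> Q <= N * S ->
  T ^- 2 * (N ^- 2 / 2) <= S * (S / (2 * (T * Q) ^+ 2)).
Proof.
move=> N0 S0 Q0 T0 QNS.
have -> : S * (S / (2 * (T * Q) ^+ 2)) = T ^- 2 * ((S / Q) ^+ 2 / 2).
  by field; rewrite !gt_eqF.
have Ti : 0 <= T ^- 2 by rewrite invr_ge0 exprn_ge0 // ltW.
rewrite ler_wpM2l // ler_wpM2r // -exprVn.
apply: lerXn2r; rewrite ?nnegrE ?invr_ge0 ?divr_ge0 // ?(ltW N0) ?(ltW S0) ?(ltW Q0) //.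
by rewrite ler_pdivlMr // ler_pdivrMl.
Qed.

Lemma inv_sqr_le1 (R : realFieldType) (N : R) :
  1 <= N -> 0 < N ^- 2 /\ N ^- 2 <= 1.
Proof.
move=> N1; have N0 : 0 < N by lra.
by rewrite invr_gt0 exprn_gt0 // invf_le1 ?exprn_gt0 // exprn_ege1.
Qed.

Lemma half_inv_sqr (R : realFieldType) (N : R) :
  1 <= N -> 0 <= N ^- 2 / 2 /\ N ^- 2 / 2 <= 2^-1.
Proof. by move=> /inv_sqr_le1[h1 h2]; split; lra. Qed.

(** Q + 1 vertices of degree at most T Q + 1 already give weight 1 / T. *)
Lemma light_sum (R : realFieldType) (T Q : R) : 2 <= T -> 0 < Q ->
  T^-1 <= (T * Q + 1)^-1 * (Q + 1).
Proof.
move=> T2 Q0; have TQ0 : 0 <= T * Q by rewrite mulr_ge0 //; lra.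
by rewrite ler_pdivlMl ?ler_pdivrMr; lra.
Qed.

(** Q + 1 - T vertices of degree at most (T-1) Q + 1 give an excess of order
    1 / T^2; this is where Q must dominate T^2. *)
Lemma heavy_gap (R : realFieldType) (T Q : R) : 2 <= T -> 1000 * T ^+ 2 <= Q ->
  ((T - 1) * Q + 1) * (T^-1 + T ^- 2 / 2) <= Q + 1 - T.
Proof.
move=> T2 TQ; have T0 : 0 < T by lra.
have h1 : T * (1000 * T ^+ 2) <= T * Q by rewrite ler_wpM2l // ltW.
have h2 : T <= T ^+ 2 by rewrite expr2 ler_peMl //; lra.
have -> : ((T - 1) * Q + 1) * (T^-1 + T ^- 2 / 2) =
    ((T - 1) * Q + 1) * (T + 2^-1) / T ^+ 2 by field; rewrite gt_eqF.
rewrite ler_pdivrMr ?exprn_gt0 //.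
have T3 : 0 < T * T ^+ 2 by rewrite mulr_gt0 ?exprn_gt0.
lra.
Qed.

(** Here h, b and n count the edges, the unbalanced edges and the vertices. *)
Lemma bound_of_excess (R : realFieldType) (T n k h b : R) :
  2 <= T -> 0 <= n -> 0 < k -> k <= 1 -> h <= 17 * b ->
  T^-1 * h + b * (T ^- 2 * (k / 2)) <= n -> h <= (T - k / 68) * n.
Proof.
move=> T2 n0 k0 k1 hb h3; have T0 : 0 < T by lra.
have h4 : T * h + b * k / 2 <= T ^+ 2 * n.
  have -> : T * h + b * k / 2 = T ^+ 2 * (T^-1 * h + b * (T ^- 2 * (k / 2))).
    by field; rewrite gt_eqF.
  by rewrite ler_pM2l // exprn_gt0.
have h5 : (T + k / 34) * h <= T ^+ 2 * n.
  by have := ler_wpM2r (ltW k0) hb; lra.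
have T1 : 0 < T + k / 34 by lra.
rewrite -(ler_pM2l T1); apply: le_trans h5 _.
have -> : (T + k / 34) * ((T - k / 68) * n) =
    T ^+ 2 * n + k / 68 * (T - k / 34) * n by field.
have k68 : 0 <= k / 68 by lra.
have Tk : 0 <= T - k / 34 by lra.
by rewrite lerDl mulr_ge0 // mulr_ge0.
Qed.

Section Average.
Variables (V : finType) (H : {set {set V}}) (q t : nat).
Hypothesis unifH : forall e, e \in H -> #|e| = q.+1.
Hypothesis linH : forall e f x y,
  e \in H -> f \in H -> x \in e -> y \in e -> x \in f -> y \in f ->
  x != y -> e = f.
Hypothesis petals_bound : forall e S, e \in H -> petals H e S -> (#|S| <= t)%N.
Variable s : nat.
Hypothesis t_gt1 : (1 < t)%N.
Hypothesis s_gt0 : (0 < s)%N.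
Hypothesis s_small : (1000 * s <= q)%N.
Hypothesis q_small : (q <= 2000 * s)%N.
Hypothesis t_small : (1000 * t ^ 2 <= q)%N.

Let bad := [set e in H | ~~ balanced H q t s e].

Let t_le_q : (t <= q)%N.
Proof.
apply: leq_trans t_small; rewrite (expnS t 1) expn1 mulnA leq_pmull //.
by rewrite muln_gt0 /= ltnW.
Qed.

(** A saturated vertex of a balanced edge has more than an eighth of its edges
    unbalanced, and saturated vertices make up at least half of each balanced
    edge; so the incidences with balanced edges number at most 16 times those
    with unbalanced edges. *)
Lemma many_unbalanced : (#|H| <= 17 * #|bad|)%N.
Proof.
have t1 : (1000 * t <= q)%N.
  by apply: leq_trans t_small; rewrite leq_mul2l /= expnS expn1 leq_pmulr // ltnW.
pose good := [set e in H | balanced H q t s e].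
have Hsplit : (#|H| <= #|good| + #|bad|)%N.
  apply: leq_trans (leq_card_setU _ _).1; apply/subset_leq_card/subsetP => e eH.
  by rewrite !inE eH; case: balanced.
suff gb : (#|good| <= 16 * #|bad|)%N by lia.
have goodP e : e \in good -> e \in H /\ balanced H q t s e by rewrite inE => /andP.
rewrite -(leq_pmul2r (m := q.+1)) //.
apply: (@leq_trans (2 * \sum_(e in good) #|[set x in e | saturated H q t s x]|)).
  rewrite -sum_nat_const big_distrr /=; apply: leq_sum => e /goodP[eH be].
  by have := card_saturated unifH eH be; lia.
have -> : (16 * #|bad| * q.+1 = 2 * (8 * (#|bad| * q.+1)))%N by lia.
rewrite leq_mul2l /=.
have -> : (#|bad| * q.+1 = \sum_(x : V) #|[set f in star H x | ~~ balanced H q t s f]|)%N.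
  rewrite -sum_nat_const.
  transitivity (\sum_(e in bad) \sum_(x : V) (x \in e))%N.
    apply: eq_bigr => e; rewrite inE => /andP[eH _].
    rewrite -(unifH eH) -sum1_card big_mkcond /=.
    by apply: eq_bigr => x _; case: (x \in e).
  rewrite exchange_big /=; apply: eq_bigr => x _; rewrite sum_indicator.
  by apply: eq_card => f; rewrite !inE -andbA [_ && (x \in f)]andbC andbA.
have -> : (\sum_(e in good) #|[set x in e | saturated H q t s x]| =
    \sum_(x : V) \sum_(e in good) ((x \in e) && saturated H q t s x))%N.
  rewrite exchange_big /=; apply: eq_bigr => e _.
  rewrite -sum1_card big_mkcond /=; apply: eq_bigr => x _.
  by rewrite inE; case: (_ && _).
rewrite big_distrr /=; apply: leq_sum => x _; rewrite sum_indicator.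
set A := [set e in good | _].
have [-> | [e]] := set_0Vmem A; first by rewrite cards0.
rewrite !inE => /andP[/andP[eH be] /andP[xe satx]].
have := many_unbalanced_at unifH linH petals_bound (ltnW t_gt1) t_gt1
  s_small t1 eH be xe satx.
move/ltnW; apply: leq_trans.
apply/subset_leq_card/subsetP => f; rewrite !inE.
by case/andP=> /andP[-> _] /andP[->].
Qed.

Variable R : realFieldType.
Local Notation degr x := ((deg H x)%:R : R).

Lemma sum_inv_deg : \sum_(e in H) \sum_(x in e) (degr x)^-1 <= #|V|%:R.
Proof.
have -> : \sum_(e in H) \sum_(x in e) (degr x)^-1 =
    \sum_(x : V) \sum_(e in star H x) (degr x)^-1.
  rewrite (exchange_big_dep predT) //=; apply: eq_bigr => x _.
  by apply: eq_bigl => e; rewrite inE.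
rewrite -sum1_card natr_sum; apply: ler_sum => x _.
rewrite sumr_const -/(deg H x) -[_^-1 *+ _]mulr_natr.
have [->|d0] := eqVneq (deg H x) 0%N; first by rewrite mulr0 ler01.
by rewrite mulVf // pnatr_eq0.
Qed.

(** An edge with a vertex of degree above t q + 1 gains by [heavy_gap]; any other
    unbalanced edge gains at its more than s unsaturated vertices. *)
Lemma inv_deg_edge e : e \in H ->
  t%:R^-1 + (e \in bad)%:R * (t%:R ^- 2 * (2000 ^- 2 / 2)) <= \sum_(x in e) (degr x)^-1.
Proof.
move=> eH.
have deg_gt0 x : x \in e -> (0 < deg H x)%N.
  by move=> xe; apply/card_gt0P; exists e; apply/starP.
have T2 : 2 <= t%:R :> R by rewrite (ler_nat _ 2).
have S1 : 1 <= s%:R :> R by rewrite (ler_nat _ 1).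
have SQ : 1000 * s%:R <= q%:R :> R by rewrite -natrM ler_nat.
have QS : q%:R <= 2000 * s%:R :> R by rewrite -natrM ler_nat.
have N0 : 0 < 2000 :> R by rewrite ltr0n.
have S0 : 0 < s%:R :> R by rewrite ltr0n.
have T0 : 0 < t%:R :> R by rewrite ltr0n ltnW.
have Q0 : 0 < q%:R :> R by rewrite ltr0n (leq_trans _ t_le_q) // ltnW.
have TQ : 1000 * t%:R ^+ 2 <= q%:R :> R by rewrite -natrX -natrM ler_nat.
have [/forall_inP degs|] := boolP [forall x in e, (deg H x <= (t * q).+1)%N].
  pose B := [set x in e | ~~ saturated H q t s x].
  have vertex x : x \in e -> (t%:R * q%:R + 1)^-1 +
      (~~ saturated H q t s x)%:R * (s%:R / (2 * (t%:R * q%:R) ^+ 2)) <= (degr x)^-1.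
    move=> xe; case: (boolP (saturated H q t s x)) => /= sx.
      rewrite mul0r addr0 -natrM natr1 lef_pV2 ?posrE ?ltr0n ?deg_gt0 //.
      by rewrite ler_nat degs.
    rewrite mul1r; apply: inv_gap; rewrite ?ltr0n ?deg_gt0 //.
      by nra.
    by rewrite -natrM -natrD ler_nat leqNgt.
  apply: le_trans (ler_sum _ vertex).
  rewrite big_split /= sumr_const unifH // -mulr_suml.
  have -> : \sum_(x in e) (~~ saturated H q t s x)%:R = #|B|%:R :> R.
    by rewrite -natr_sum sum_indicator.
  have many : e \in bad -> s%:R <= #|B|%:R :> R.
    (* An edge with all degrees at most t q + 1 can only fail the second clause. *)
    rewrite inE eH /= negb_and => /orP[/negP[]|]; first exact/forall_inP.
    by rewrite -ltnNge ler_nat => /ltnW.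
  apply: lerD.
    rewrite -[_^-1 *+ _]mulr_natr -natr1.
    exact: light_sum.
  case: (boolP (e \in bad)) => [/many sB|_]; last first.
    by rewrite mul0r mulr_ge0 // divr_ge0 // mulr_ge0 ?exprn_ge0 ?mulr_ge0.
  apply: le_trans (ler_wpM2r _ sB); last by rewrite divr_ge0 // mulr_ge0 // exprn_ge0 // mulr_ge0.
  by rewrite mul1r; exact: (light_gap N0 S0 Q0 T0 QS).
rewrite negb_forall_in => /exists_inP[v ve]; rewrite -ltnNge => big.
have t_gt0 : (0 < t)%N by apply: ltnW.
have fewR : (#|[set x in e | t.-1 * q + 2 <= deg H x]| <= t)%N.
  by apply: (heavy_edge_few_large unifH linH petals_bound t_gt0 eH ve); rewrite addn2.
set A := [set x in e | _] in fewR.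
have cA : (q.+1 - t <= #|e :\: A|)%N.
  rewrite -(unifH eH) -(cardsID A e) leq_subLR addnC [X in (_ <= X)%N]addnC.
  by rewrite leq_add2l (leq_trans _ fewR) // subset_leq_card // subsetIr.
rewrite (big_setID A) /=; apply: le_trans (ler_wpDl _ (lexx _)); last first.
  by apply: sumr_ge0 => x _; rewrite invr_ge0.
have light x : x \in e :\: A -> ((t%:R - 1) * q%:R + 1)^-1 <= (degr x)^-1.
  rewrite !inE => /andP[+ xe]; rewrite xe /= -ltnNge addn2 ltnS => dx.
  rewrite lef_pV2 ?posrE ?ltr0n ?deg_gt0 //; last by nra.
  have -> : (t%:R - 1) * q%:R + 1 = (t.-1 * q).+1%:R :> R.
    by rewrite -natr1 natrM -subn1 natrB.
  by rewrite ler_nat.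
apply: le_trans (ler_sum _ light); rewrite sumr_const -[_^-1 *+ _]mulr_natr.
have cAR : q%:R + 1 - t%:R <= #|e :\: A|%:R :> R.
  by rewrite natr1 -natrB ?ler_nat // ltnW.
have [k0 k1] : 0 <= 2000 ^- 2 / 2 :> R /\ 2000 ^- 2 / 2 <= 2^-1 :> R.
  by apply: half_inv_sqr; rewrite (ler_nat _ 1).
move: (2000 ^- 2 / 2) k0 k1 => k k0 k1.
have Tk : t%:R ^- 2 * k <= t%:R ^- 2 / 2 :> R.
  by rewrite ler_wpM2l // invr_ge0 exprn_ge0.
apply: (@le_trans _ _ (t%:R^-1 + t%:R ^- 2 / 2)).
  rewrite lerD2l; apply: le_trans Tk; rewrite -[X in _ <= X]mul1r.
  by rewrite ler_wpM2r ?lern1 ?leq_b1 // mulr_ge0 // invr_ge0 exprn_ge0.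
have Dpos : 0 < (t%:R - 1) * q%:R + 1 :> R.
  by rewrite ltr_wpDl // mulr_ge0 // subr_ge0 (ler_nat _ 1).
apply: le_trans (ler_wpM2l _ cAR); last by rewrite invr_ge0 ltW.
rewrite ler_pdivlMl //.
exact: heavy_gap.
Qed.

Lemma edge_bound : #|H|%:R <= (t%:R - 2000 ^- 2 / 68) * #|V|%:R :> R.
Proof.
have t0 : 2 <= t%:R :> R by rewrite (ler_nat _ 2).
have := sum_inv_deg.
have : \sum_(e in H) (t%:R^-1 + (e \in bad)%:R * (t%:R ^- 2 * (2000 ^- 2 / 2)))
    <= \sum_(e in H) \sum_(x in e) (degr x)^-1.
  by apply: ler_sum => e; apply: inv_deg_edge.
rewrite big_split /= sumr_const -mulr_suml.
have -> : \sum_(e in H) (e \in bad)%:R = #|bad|%:R :> R.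
  rewrite -natr_sum sum_indicator; congr (_%:R); apply: eq_card => e.
  by rewrite !inE; case: (e \in H).
have : #|H|%:R <= 17 * #|bad|%:R :> R by rewrite -natrM ler_nat many_unbalanced.
rewrite -[_^-1 *+ _]mulr_natr.
have [k0 k1] : 0 < 2000 ^- 2 :> R /\ 2000 ^- 2 <= 1 :> R.
  by apply: inv_sqr_le1; rewrite (ler_nat _ 1).
move=> hb h1 h2; apply: (bound_of_excess t0 (ler0n R #|V|) k0 k1 hb).
exact: le_trans h1 h2.
Qed.

End Average.

(** * Crown-free hypergraphs *)

Section CrownPetals.
Variables (V : finType) (H : {set {set V}}) (q t : nat).
Hypothesis unifH : forall e, e \in H -> #|e| = q.+1.
Hypothesis linH : forall e f x y,
  e \in H -> f \in H -> x \in e -> y \in e -> x \in f -> y \in f ->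
  x != y -> e = f.

(** Petals are disjoint, so their feet are distinct, and any t + 1 of them form
    a crown with e. *)
Lemma crown_free_petals e S :
  crown_free t.+1 H -> e \in H -> petals H e S -> (#|S| <= t)%N.
Proof.
move=> + eH pS; apply: contraTT; rewrite -ltnNge => tS; apply/negPn.
have [x0 _] : exists x, x \in e by apply/card_gt0P; rewrite unifH.
pose p := [ffun i : 'I_t.+1 => enum_val (widen_ord tS i)].
pose v := [ffun i => odflt x0 [pick x in e :&: p i]].
have pP i : p i \in S by rewrite ffunE enum_valP.
have p_inj : injective p.
  by move=> i j; rewrite !ffunE => /enum_val_inj/(congr1 val)/= /val_inj.
have vP i : v i \in e /\ v i \in p i.
  have [u ue uf] := petal_foot pS (pP i).
  rewrite [v i]ffunE; case: pickP => [x /setIP[]//|/(_ u)].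
  by rewrite !inE ue uf.
apply/exists_inP; exists e => //; apply/existsP; exists p; apply/existsP; exists v.
apply/andP; split; first by apply/forallP => i; apply: petal_edge pS _ (pP i).
apply/and3P; split.
- apply/injectiveP => i j vij; apply: p_inj.
  have [_ vi] := vP i; have [_ vj] := vP j.
  by apply: (petal_disj pS (x := v i)) => //; rewrite vij.
- apply/forallP => i; apply/eqP/setP => z; rewrite in_setI in_set1.
  have [ve vp] := vP i; apply/andP/eqP => [[ze zp]|->//].
  apply: (edge_meet_uniq linH (e := e) (g := p i)) => //.
    exact: petal_edge pS _ (pP i).
  exact: petal_neq pS _ (pP i).
- apply/forallP => i; apply/forallP => j; apply/implyP => ij.
  apply: contraNT ij => /meetP[z zi zj]; apply/eqP/p_inj.
  exact: (petal_disj pS (x := z)).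
Qed.

End CrownPetals.

Lemma linear_hypergraph_eq (V : finType) (H : {set {set V}}) e f x y :
  linear_hypergraph H -> e \in H -> f \in H -> x \in e -> y \in e ->
  x \in f -> y \in f -> x != y -> e = f.
Proof.
move=> /forall_inP lin eH fH xe ye xf yf; apply: contraNeq => ef.
have /forall_inP/(_ f fH)/implyP/(_ ef) := lin e eH.
by move/card_le1_eqP; move/(_ x y); rewrite !inE xe ye xf yf => /(_ isT isT) ->.
Qed.

(** The slack s is q / 1000 rounded down; its ratio to q stays above 1 / 2000,
    whence the constant. *)
Lemma ex_lin_bound (R : realFieldType) (q t n : nat) :
  (1 < t)%N -> (1000 * t ^ 2 <= q)%N ->
  (ex_lin q.+1 t.+1 n)%:R <= (t%:R - 2000 ^- 2 / 68) * n%:R :> R.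
Proof.
move=> t1 tq; rewrite /ex_lin.
have q1000 : (1000 <= q)%N.
  by apply: leq_trans tq; rewrite leq_pmulr // expn_gt0 ltnW.
have s0 : (0 < q %/ 1000)%N by rewrite divn_gt0.
have sq : (1000 * (q %/ 1000) <= q)%N by rewrite mulnC leq_divM.
have qs : (q <= 2000 * (q %/ 1000))%N.
  by have := ltn_ceil q (isT : (0 < 1000)%N); move: (q %/ 1000)%N s0 => s; clear; lia.
have c_ge0 : 0 <= t%:R - 2000 ^- 2 / 68 :> R.
  have [k0 k1] : 0 < 2000 ^- 2 :> R /\ 2000 ^- 2 <= 1 :> R.
    by apply: inv_sqr_le1; rewrite (ler_nat _ 1).
  have T2 : 2 <= t%:R :> R by rewrite (ler_nat _ 2).
  by move: (2000 ^- 2) (t%:R) k0 k1 T2 => k T k0 k1 T2; clear - k0 k1 T2; lra.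
elim/big_ind: _ => [|m m' Hm Hm'|H /and3P[/forall_inP unif lin cf]].
- by rewrite mulr_ge0.
- by rewrite /maxn; case: ifP.
rewrite -[n in X in _ <= X]card_ord.
have unif' e : e \in H -> #|e| = q.+1 by move/unif/eqP.
have lin' := fun e f x y => @linear_hypergraph_eq _ H e f x y lin.
apply: (edge_bound unif' lin' _ t1 s0 sq qs tq) => e S eH.
exact: (crown_free_petals unif' lin').
Qed.

Lemma limn_esup_le_bound (R : realType) (u : nat -> \bar R) (c : \bar R) :
  (forall n, (u n <= c)%E) -> (limn_esup u <= c)%E.
Proof.
move=> uc; rewrite limn_esup_lim; apply: lime_le; first exact: is_cvg_esups.
apply: nearW => n; apply: ge_ereal_sup => _ [m _ <-]; exact: uc.
Qed.

Theorem corollary10p1 (R : realType) :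
  exists Q0 c0 : R, 0 < c0 /\
    forall t q : nat, (2 <= t)%N -> (t <= q)%N ->
      Q0 * t%:R ^+ 2 <= q%:R ->
      (c_lin R q.+1 t.+1 <= (t%:R - c0 / t%:R)%:E)%E.
Proof.
have [k0 k1] : 0 < 2000 ^- 2 :> R /\ 2000 ^- 2 <= 1 :> R.
  by apply: inv_sqr_le1; rewrite (ler_nat _ 1).
exists 1000, (2000 ^- 2 / 68); split; first by rewrite divr_gt0.
move=> t q t2 _; rewrite -natrX -natrM ler_nat => tq.
have bound n := @ex_lin_bound R q t n t2 tq.
have c0 : 0 < 2000 ^- 2 / 68 :> R by rewrite divr_gt0.
have c1 : 2000 ^- 2 / 68 <= 1 :> R by rewrite ler_pdivrMr // mul1r (le_trans k1) // (ler_nat _ 1).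
move: (2000 ^- 2 / 68) c0 c1 bound => c c0 c1 bound {k0 k1}.
have T2 : 2 <= t%:R :> R by rewrite (ler_nat _ 2).
have ct : c / t%:R <= c by rewrite ler_pdivrMr ?ler_peMr //; lra.
apply: limn_esup_le_bound => n; rewrite lee_fin.
have [->|n0] := posnP n; first by rewrite invr0 mulr0; lra.
rewrite ler_pdivrMr ?ltr0n //; apply: le_trans (bound n) _.
by rewrite ler_wpM2r // lerD2l lerN2.
Qed.
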